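(* Let $n \ge 1$ and let $f_{1,n}, f_{2,n} : [1]\times[2]\times\cdots\times[n] \to S_n$ be the bijections defined in the context. The fixed points of the map $f_{1,n}\circ f_{2,n}^{-1} : S_n \to S_n$ are exactly the involutions of $S_n$ written backwards. That is, for $\sigma\in S_n$, one has $f_{1,n}(f_{2,n}^{-1}(\sigma)) = \sigma$ if and only if the permutation whose one-line notation is $\sigma[n]\,\sigma[n-1]\cdots\sigma[1]$ is an involution.
   Context: Notation: $[m]=\{1,2,\dots,m\}$, and $S_n$ is the set of permutations of $[n]$. A permutation $\sigma$ is identified with its one-line notation, and $\sigma[i]$ is its $i$-th entry from the left, i.e. $\sigma[i]$ is the image of $i$ under $\sigma$. A word is an element $w\in[1]\times[2]\times\cdots\times[n]$; $w[i]$ is its $i$-th letter from the left, so $1\le w[i]\le i$. An involution is a permutation equal to its own inverse (the identity included). Definition of $f_{1,n}$ (recursive): $f_{1,1}(1)=1$. For $n\ge 2$, let $w'$ be the word formed by the first $n-1$ letters of $w$. Then $f_{1,n}(w)$ is the one-line word obtained from the one-line word $f_{1,n-1}(w')$ by inserting $n$ so that it occupies the $w[n]$-th position counting from the right in the resulting word. (Examples for $n=3$: $112\mapsto 132$, $113\mapsto 312$, $121\mapsto 213$.) Definition of $f_{2,n}$: read $w$ backwards, for $i=n,n-1,\dots,1$, starting from the empty one-line word. At step $i$, append at the right end the $w[i]$-th smallest element of $[n]$ that has not yet been placed. The resulting one-line word is $f_{2,n}(w)$. (Examples for $n=3$: $112\mapsto 213$, $113\mapsto 312$, $121\mapsto 132$.)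 Both maps are bijections. *)

(* Defs.v *)
From mathcomp Require Import all_boot all_fingroup zify.

Set Implicit Arguments.
Unset Strict Implicit.
Unset Printing Implicit Defensive.

(* 'S_n permutes {0, ..., n-1}; the one-line notation is shifted so that, as
   usual, its entries are 1, ..., n. *)
Definition oneline n (s : 'S_n) : seq nat := [seq (s i).+1 | i <- enum 'I_n].

Lemma size_oneline n (s : 'S_n) : size (oneline s) = n.
Proof. by rewrite size_map size_enum_ord. Qed.

Lemma nth_oneline n (s : 'S_n) (i : 'I_n) : nth 0 (oneline s) i = (s i).+1.
Proof. by rewrite (nth_map i) ?size_enum_ord // nth_ord_enum. Qed.

Lemma oneline_inj n : injective (@oneline n).
Proof.
move=> s t E; apply/permP=> i; apply/val_inj/eqP.
by rewrite -eqSS /= -!nth_oneline E.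
Qed.

Lemma perm_eq_iotaP n (s : seq nat) :
  uniq s -> size s = n -> {subset s <= iota 1 n} -> perm_eq s (iota 1 n).
Proof.
move=> us ss sub; apply: uniq_perm => //; first exact: iota_uniq.
by case: (uniq_min_size us sub); rewrite ?size_iota ?ss.
Qed.

Lemma oneline_perm n (s : 'S_n) : perm_eq (oneline s) (iota 1 n).
Proof.
apply: perm_eq_iotaP; last 1 first.
- by move=> x /mapP[i _ ->]; rewrite mem_iota /= add1n ltnS.
- rewrite map_inj_uniq ?enum_uniq // => i j [] /val_inj; exact: perm_inj.
- exact: size_oneline.
Qed.

(* The permutation with one-line notation l; insubd never uses its default
   value when l is an arrangement of 1, ..., n. *)
Definition line_fun n (l : seq nat) (i : 'I_n) : 'I_n :=
  insubd i (nth 0 l i).-1.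

Lemma val_line_fun n l (i : 'I_n) : perm_eq l (iota 1 n) ->
  (line_fun l i).+1 = nth 0 l i.
Proof.
move=> pl; have sl : size l = n by rewrite (perm_size pl) size_iota.
have : nth 0 l i \in iota 1 n by rewrite -(perm_mem pl) mem_nth ?sl.
rewrite mem_iota => b; rewrite /line_fun val_insubd; case: ifP; lia.
Qed.

Lemma line_fun_inj n l : perm_eq l (iota 1 n) -> injective (@line_fun n l).
Proof.
move=> pl i j /(congr1 (fun k : 'I_n => k.+1)); rewrite !val_line_fun // => /eqP.
have sl : size l = n by rewrite (perm_size pl) size_iota.
rewrite nth_uniq ?sl // ?(perm_uniq pl) ?iota_uniq // => /eqP; exact: val_inj.
Qed.

Definition perm_of_line n l (pl : perm_eq l (iota 1 n)) : 'S_n :=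
  perm (line_fun_inj pl).

Lemma perm_of_lineK n l (pl : perm_eq l (iota 1 n)) :
  oneline (perm_of_line pl) = l.
Proof.
have sl : size l = n by rewrite (perm_size pl) size_iota.
apply: (@eq_from_nth _ 0) => [|i]; rewrite size_oneline ?sl // => lt_in.
by rewrite (nth_oneline _ (Ordinal lt_in)) permE val_line_fun.
Qed.

(* The set [1] x [2] x ... x [n]: letters are 1-based, so the letter at
   0-based position i lies between 1 and i.+1. *)
Definition word n :=
  {w : n.-tuple 'I_n.+1 | [forall i : 'I_n, 1 <= tnth w i <= i.+1]}.

Definition letters n (w : word n) : seq nat := [seq val a | a <- val w].

Lemma size_letters n (w : word n) : size (letters w) = n.
Proof. by rewrite size_map size_tuple. Qed.

Lemma letters_bound n (w : word n) i : i < n -> 1 <= nth 0 (letters w) i <= i.+1.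
Proof.
move=> lt_in; have /forallP/(_ (Ordinal lt_in)) := valP w.
by rewrite (tnth_nth ord0) (nth_map ord0) ?size_tuple.
Qed.

Lemma letters_inj n : injective (@letters n).
Proof. by move=> w v /(inj_map val_inj) /val_inj /val_inj. Qed.

Lemma letters_onto n (l : seq nat) : size l = n ->
  (forall i, i < n -> 1 <= nth 0 l i <= i.+1) -> exists w : word n, letters w = l.
Proof.
move=> sl bl.
pose t : n.-tuple 'I_n.+1 := [tuple inord (nth 0 l i) | i < n].
have tE (i : 'I_n) : tnth t i = nth 0 l i :> nat.
  by rewrite tnth_mktuple inordK //; have := bl i (ltn_ord i); have := ltn_ord i; lia.
have wt : [forall i : 'I_n, 1 <= tnth t i <= i.+1].
  by apply/forallP=> i; rewrite tE bl.
exists (Sub t wt : word n); apply: (@eq_from_nth _ 0); rewrite size_letters ?sl //.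
move=> i lt_in; rewrite /letters SubK (nth_map ord0) ?size_tuple //.
by have := tE (Ordinal lt_in); rewrite (tnth_nth ord0).
Qed.

(* Insert x into l at the k-th position counting from the right of the result
   (1 <= k <= size l + 1). *)
Definition insert_from_right (k x : nat) (l : seq nat) : seq nat :=
  let j := size l - k.-1 in take j l ++ x :: drop j l.

Lemma perm_insert k x l : perm_eq (insert_from_right k x l) (x :: l).
Proof. by rewrite perm_catC /= perm_cons perm_catC cat_take_drop. Qed.

(* Only the first n letters of w are read; w[n] is nth 0 w n.-1. *)
Fixpoint f1_line (n : nat) (w : seq nat) : seq nat :=
  if n is m.+1 then insert_from_right (nth 0 w m) m.+1 (f1_line m w) else [::].

Lemma f1_line_perm n (w : seq nat) : perm_eq (f1_line n w) (iota 1 n).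
Proof.
elim: n => // n IH; rewrite -addn1 iotaD add1n addn1 /=.
by rewrite (permPl (perm_insert _ _ _)) -cat1s perm_catC perm_cat2r.
Qed.

Definition f1 n (w : word n) : 'S_n := perm_of_line (f1_line_perm n (letters w)).

Definition unplaced n (l : seq nat) : seq nat := [seq x <- iota 1 n | x \notin l].

(* Performs steps i, i-1, ..., 1, where l is the word built so far; step i
   appends the w[i]-th element of the increasing sequence unplaced n l. *)
Fixpoint f2_steps (n : nat) (w : seq nat) (i : nat) (l : seq nat) : seq nat :=
  if i is j.+1 then
    f2_steps n w j (rcons l (nth 0 (unplaced n l) (nth 0 w j).-1))
  else l.

Definition f2_line n (w : seq nat) : seq nat := f2_steps n w n [::].

Example f1_line_3 :
  [/\ f1_line 3 [:: 1; 1; 2] = [:: 1; 3; 2], f1_line 3 [:: 1; 1; 3] = [:: 3; 1; 2]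
    & f1_line 3 [:: 1; 2; 1] = [:: 2; 1; 3]].
Proof. by []. Qed.

Example f2_line_3 :
  [/\ f2_line 3 [:: 1; 1; 2] = [:: 2; 1; 3], f2_line 3 [:: 1; 1; 3] = [:: 3; 1; 2]
    & f2_line 3 [:: 1; 2; 1] = [:: 1; 3; 2]].
Proof. by []. Qed.

Lemma size_unplaced n l : uniq l -> {subset l <= iota 1 n} ->
  size (unplaced n l) = n - size l.
Proof.
move=> ul sub; rewrite size_filter.
have := count_predC (mem l) (iota 1 n); rewrite size_iota.
have -> : count (mem l) (iota 1 n) = size l.
  rewrite -size_filter; apply: perm_size; apply: uniq_perm => //.
    exact/filter_uniq/iota_uniq.
  by move=> x; rewrite mem_filter /=; case: (boolP (x \in l)) => // /sub.
by move=> E; rewrite -[in RHS]E addKn; apply: eq_count.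
Qed.

Lemma f2_steps_perm n w i l : (forall j, j < i -> 1 <= nth 0 w j <= j.+1) ->
  uniq l -> {subset l <= iota 1 n} -> size l + i = n ->
  perm_eq (f2_steps n w i l) (iota 1 n).
Proof.
elim: i l => [|i IH] l bw ul sub sl /=.
  by apply: perm_eq_iotaP; rewrite // -sl addn0.
set x := nth 0 (unplaced n l) _; have : x \in unplaced n l.
  by rewrite mem_nth // size_unplaced //; have := bw i (leqnn _); lia.
rewrite mem_filter => /andP[xl xn].
apply: IH => [j lt_ji||z|]; first by apply: bw; lia.
- by rewrite rcons_uniq xl.
- by rewrite mem_rcons inE => /predU1P[->|/sub].
- by rewrite size_rcons; lia.
Qed.

Lemma f2_line_perm n (w : word n) : perm_eq (f2_line n (letters w)) (iota 1 n).
Proof. by apply: f2_steps_perm => // j; apply: letters_bound. Qed.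

Definition f2 n (w : word n) : 'S_n := perm_of_line (f2_line_perm w).

Lemma f2_steps_prefix n w i l : prefix l (f2_steps n w i l).
Proof.
elim: i l => [|i IH] l /=; first exact: prefix_refl.
exact: prefix_trans (prefix_rcons _ _) (IH _).
Qed.

Lemma f2_steps_inj n w v i l :
  (forall j, j < i -> 1 <= nth 0 w j <= j.+1) ->
  (forall j, j < i -> 1 <= nth 0 v j <= j.+1) ->
  uniq l -> {subset l <= iota 1 n} -> size l + i = n ->
  f2_steps n w i l = f2_steps n v i l ->
  forall j, j < i -> nth 0 w j = nth 0 v j.
Proof.
elim: i l => [|i IH] l bw bv ul sub sl //=.
set x := nth 0 (unplaced n l) (nth 0 w i).-1.
set y := nth 0 (unplaced n l) (nth 0 v i).-1 => E.
have ub u : 1 <= u <= i.+1 -> u.-1 < size (unplaced n l).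
  by rewrite size_unplaced //; lia.
have bwi := bw i (leqnn _); have bvi := bv i (leqnn _).
have xy : x = y.
  have := f2_steps_prefix n w i (rcons l x); have := f2_steps_prefix n v i (rcons l y).
  rewrite E !prefixE !size_rcons => /eqP-> /eqP /rcons_inj[//].
have : x \in unplaced n l by rewrite mem_nth ?ub.
rewrite mem_filter => /andP[xl xn] j.
rewrite ltnS leq_eqVlt => /predU1P[->|].
  move/eqP: xy; rewrite nth_uniq ?ub //; last exact/filter_uniq/iota_uniq.
  lia.
apply: (IH (rcons l x)) => [k ? | k ? | | z | | ].
- by apply: bw; lia.
- by apply: bv; lia.
- by rewrite rcons_uniq xl.
- by rewrite mem_rcons inE => /predU1P[->|/sub].
- by rewrite size_rcons; lia.
- by rewrite E xy.
Qed.

Lemma f2_inj n : injective (@f2 n).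
Proof.
move=> w v /(congr1 (@oneline n)); rewrite !perm_of_lineK => E.
apply: letters_inj; apply: (@eq_from_nth _ 0); rewrite !size_letters // => i lt_in.
by apply: (f2_steps_inj _ _ _ _ _ E) => // j; apply: letters_bound.
Qed.

Lemma f2_onto n (s : 'S_n) : s \in codom (@f2 n).
Proof.
set t := oneline s; have st : size t = n by apply: size_oneline.
have pt : perm_eq t (iota 1 n) by apply: oneline_perm.
have ut : uniq t by rewrite (perm_uniq pt) iota_uniq.
pose c j := index (nth 0 t (n - j.+1)) (unplaced n (take (n - j.+1) t)).
have takeE j : j < n -> take (n - j) t = rcons (take (n - j.+1) t) (nth 0 t (n - j.+1)).
  move=> lt_jn; rewrite -take_nth ?st; last lia.
  by rewrite subnSK.
have in_c j : j < n -> nth 0 t (n - j.+1) \in unplaced n (take (n - j.+1) t).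
  move=> lt_jn; rewrite mem_filter -(perm_mem pt) mem_nth ?st; last lia.
  by have := take_uniq (n - j) ut; rewrite (takeE j) // rcons_uniq => /andP[->].
have c_bound j : j < n -> c j <= j.
  move=> lt_jn; have := in_c j lt_jn; rewrite -index_mem size_unplaced.
  - by rewrite size_takel ?st; rewrite /c; lia.
  - exact: take_uniq.
  - by move=> x /mem_take; rewrite (perm_mem pt).
have [||w wE] := @letters_onto n (mkseq (fun j => (c j).+1) n).
- by rewrite size_mkseq.
- by move=> i lt_in; rewrite nth_mkseq //=; exact: c_bound.
suff f2t i : i <= n -> f2_steps n (letters w) i (take (n - i) t) = t.
  apply/codomP; exists w; apply: oneline_inj; rewrite perm_of_lineK -/t /f2_line.
  by rewrite -[in LHS](f2t n) // subnn take0.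
elim: i => [_|i IH lt_in] /=; first by rewrite subn0 take_oversize ?st.
rewrite wE nth_mkseq //= nth_index ?in_c // -takeE // -wE.
by apply: IH; lia.
Qed.

Definition f2_inv n (s : 'S_n) : word n := iinv (f2_onto s).

Lemma f2_invK n : cancel (@f2_inv n) (@f2 n).
Proof. by move=> s; apply: f_iinv. Qed.

Lemma f2K n : cancel (@f2 n) (@f2_inv n).
Proof. by move=> w; apply: f2_inj; rewrite f2_invK. Qed.

Definition backwards n (s : 'S_n) : 'S_n :=
  perm (inj_comp (@perm_inj _ s) (@rev_ord_inj n)).

Lemma oneline_backwards n (s : 'S_n) : oneline (backwards s) = rev (oneline s).
Proof.
apply: (@eq_from_nth _ 0) => [|i]; rewrite ?size_rev !size_oneline // => lt_in.
rewrite nth_rev size_oneline // (nth_oneline _ (Ordinal lt_in)) permE /=.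
by rewrite -(nth_oneline _ (rev_ord (Ordinal lt_in))).
Qed.

Definition involution n (s : 'S_n) : Prop := s^-1%g = s.

(* Main.v *)
Require Import Defs.
From mathcomp Require Import all_boot all_fingroup.
From mathcomp Require Import zify.

Set Implicit Arguments.
Unset Strict Implicit.
Unset Printing Implicit Defensive.

(** Both maps decode a word as an inversion table, one into a permutation and the
    other into its inverse, up to writing backwards. For a permutation r, let L(r) be the table whose entry at
    i is the number of j < i with r(j) < r(i), that is, the rank of r(i) among
    the earlier values.

    - In f2(w), the letter read at a given place selects a value by its rank
      among the unplaced values, which are those that end up at this place or to
      the right of it. Reading f2(w) backwards turns later
      positions into earlier ones, so w - 1 = L(backwards (f2 w)) (letter_f2).

    - In f1(w), the k-th letter says how many of the values 1, ..., k-1 stand to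
      the right of k, and inserting larger values later does not change this.
      Read backwards, these are the values j < k that stand before k, which is a
      condition on the positions of j and k, hence on the inverse permutation:
      w - 1 = L((backwards (f1 w))^-1) (letter_f1).

    The table L(r) determines r, because by the first point it determines the
    word that f2 sends to backwards r. Therefore
    backwards (f1 w) = (backwards (f2 w))^-1 for every word w (backwards_f1).
    With f2(w) = sigma, the equation f1(w) = sigma says exactly that
    backwards sigma is its own inverse. *)

(** * Smaller entries to the right in a one-line word *)

(** The statistic that both constructions control. The entry x itself is kept in
    the suffix, where it does not count. *)
Definition smaller_after (x : nat) (s : seq nat) : nat :=
  count (fun y => y < x) (drop (index x s) s).

Lemma smaller_after_insert_larger x z s1 s2 : x < z ->
  smaller_after x (s1 ++ z :: s2) = smaller_after x (s1 ++ s2).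
Proof.
move=> lt_xz; rewrite /smaller_after.
elim: s1 => [|y s1 IH] /=; first by rewrite gtn_eqF /=.
by case: eqP => //= _; rewrite !count_cat /= (leq_gtF (ltnW lt_xz)).
Qed.

(** At its insertion, k is larger than everything present, so its letter counts
    all the entries to its right, itself included; afterwards only larger
    entries come in, and the count of smaller ones is frozen. *)
Lemma f1_line_letter n w k : (forall j, j < n -> 1 <= nth 0 w j <= j.+1) ->
  k < n -> nth 0 w k = (smaller_after k.+1 (f1_line n w)).+1.
Proof.
elim: n => // n IH bw; rewrite ltnS leq_eqVlt => /predU1P[-> | lt_kn] /=.
  have pl := f1_line_perm n w; set l := f1_line n w in pl *.
  have sl : size l = n by rewrite (perm_size pl) size_iota.
  have small y : y \in l -> y < n.+1 by rewrite (perm_mem pl) mem_iota; lia.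
  have notin : n.+1 \notin l by apply/negP=> /small; lia.
  rewrite /smaller_after /insert_from_right; set j := _ - _.
  have notinj : n.+1 \notin take j l by apply: contra notin; apply: mem_take.
  rewrite index_cat (negbTE notinj) /= eqxx addn0 drop_size_cat //= ltnn add0n.
  have -> : count (fun y => y < n.+1) (drop j l) = size (drop j l).
    by apply/eqP; rewrite -all_count; apply/allP=> y /mem_drop /small.
  by rewrite size_drop /j sl; have := bw n (leqnn _); lia.
rewrite smaller_after_insert_larger; last by rewrite ltnS.
by rewrite cat_take_drop; apply: IH => // j lt_jn; apply: bw; lia.
Qed.

(** In an increasing sequence, the position of an entry is the number of smaller
    entries; this turns the choice of a k-th smallest element into a count. *)
Lemma index_iota_filter (p : pred nat) m k x :
  x \in [seq y <- iota m k | p y] ->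
  index x [seq y <- iota m k | p y] = count (fun y => y < x) [seq y <- iota m k | p y].
Proof.
have: sorted ltn [seq y <- iota m k | p y].
  by apply: sorted_filter (iota_ltn_sorted _ _); apply: ltn_trans.
elim: (filter _ _) => //= y s IH sy; have: all (ltn y) s by apply: order_path_min sy; apply: ltn_trans.
rewrite inE eq_sym => /allP lt_ys; case: eqP => /= [<- _ | _ xs].
  by rewrite ltnn -[LHS](count_pred0 s); apply: eq_in_count => z /lt_ys /=; lia.
by have /= -> := lt_ys _ xs; rewrite (IH (path_sorted sy) xs).
Qed.

(** When x is chosen, the unplaced values are those of the suffix that starts at
    x in the final word, so the rank of x among them counts the smaller entries
    to its right. *)
Lemma f2_steps_letter n w i l : (forall j, j < i -> 1 <= nth 0 w j <= j.+1) ->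
  uniq l -> {subset l <= iota 1 n} -> size l + i = n ->
  let s := f2_steps n w i l in forall j, j < i ->
  nth 0 w j = (smaller_after (nth 0 s (n - j.+1)) s).+1.
Proof.
elim: i l => [|i IH] l bw ul sub sl //= j.
have := f2_steps_perm bw ul sub sl => /=.
set k := (nth 0 w i).-1; set x := nth 0 (unplaced n l) k.
have bwi := bw i (leqnn _).
have lt_k : k < size (unplaced n l) by rewrite size_unplaced //; lia.
have x_in : x \in unplaced n l by rewrite mem_nth.
have := x_in; rewrite mem_filter => /andP[xl xn].
move=> ps; rewrite ltnS leq_eqVlt => /predU1P[-> | lt_ji]; last first.
  apply: (IH (rcons l x)) => // [p ? | | z | ].
  - by apply: bw; lia.
  - by rewrite rcons_uniq xl.
  - by rewrite mem_rcons inE => /predU1P[->|/sub].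
  - by rewrite size_rcons; lia.
(* The letter read first: the final word is l, then x, then some t. *)
have [t st] := prefixP (f2_steps_prefix n w i (rcons l x)).
rewrite st cat_rcons in ps *; have -> : n - i.+1 = size l by lia.
rewrite nth_cat ltnn subnn /= /smaller_after index_cat (negbTE xl) /= eqxx addn0.
rewrite drop_size_cat //.
have /seq.permP <- : perm_eq (unplaced n l) (x :: t).
  have us : uniq (l ++ x :: t) by rewrite (perm_uniq ps) iota_uniq.
  apply: uniq_perm; [exact/filter_uniq/iota_uniq| |move=> y].
    by move: us; rewrite cat_uniq => /and3P[].
  rewrite mem_filter -(perm_mem ps) mem_cat.
  move: us; rewrite cat_uniq => /and3P[_ /hasPn dis _].
  by case: (boolP (y \in x :: t)) => [/dis /= -> | _]; rewrite ?orbT ?orbF ?andNb.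
rewrite -index_iota_filter // -/(unplaced n l) index_uniq ?filter_uniq ?iota_uniq //; lia.
Qed.

(** * Inversion tables of permutations *)

(** The entry at i of the inversion table L(r); it counts from 0, one less than
    the corresponding letter of a word. *)
Definition rank_among_previous n (r : 'S_n) (i : 'I_n) : nat :=
  #|[set j : 'I_n | (j < i) && (r j < r i)]|.

Lemma drop_enum_ord n p : p <= n ->
  drop p (enum 'I_n) = [seq q : 'I_n <- enum 'I_n | p <= q].
Proof.
move=> le_pn; apply: (inj_map val_inj).
rewrite map_drop -(filter_map val (leq p)) val_enum_ord drop_iota.
rewrite -[in RHS](subnKC le_pn) iotaD filter_cat !add0n.
rewrite (_ : filter _ (iota 0 p) = [::]) ?cat0s.
  by apply/esym/all_filterP/allP=> q; rewrite mem_iota => /andP[].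
by apply/eqP; rewrite -[_ == _]negbK -has_filter; apply/hasPn=> q; rewrite mem_iota /=; lia.
Qed.

Lemma smaller_after_oneline n (s : 'S_n) (p : 'I_n) :
  smaller_after (s p).+1 (oneline s) = #|[set q : 'I_n | (p < q) && (s q < s p)]|.
Proof.
have us : uniq (oneline s) by rewrite (perm_uniq (oneline_perm s)) iota_uniq.
rewrite /smaller_after -(nth_oneline s p) index_uniq ?size_oneline // nth_oneline.
rewrite /oneline -map_drop count_map.
rewrite drop_enum_ord; last exact: ltnW.
rewrite count_filter cardE -size_filter {2}/enum_mem -enumT /=.
rewrite !size_filter; apply: eq_count => q; rewrite !inE /= ltnS andbC.
by rewrite (leq_eqVlt p) (inj_eq val_inj); case: eqP => [->|_]; rewrite ?ltnn ?andbF.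
Qed.

(** Going backwards exchanges earlier and later positions. *)
Lemma rank_backwards n (s : 'S_n) (i : 'I_n) :
  rank_among_previous (backwards s) i = smaller_after (s (rev_ord i)).+1 (oneline s).
Proof.
rewrite smaller_after_oneline -(card_imset _ (@rev_ord_inj n)).
apply: eq_card => j; rewrite -[j in RHS]rev_ordK mem_imset ?inE; last exact: rev_ord_inj.
by rewrite !permE /=; have := ltn_ord i; have := ltn_ord j; lia.
Qed.

Lemma backwards_invE n (s : 'S_n) (i : 'I_n) :
  ((backwards s)^-1)%g i = rev_ord ((s^-1)%g i).
Proof. by apply: (@perm_inj _ (backwards s)); rewrite permKV permE /= rev_ordK permKV. Qed.

(** The inverse permutation lists positions by value: j < i compares two values
    and the other inequality their positions, so substituting j = s q gives the
    entries q to the right of the value i that are smaller than it. *)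
Lemma rank_backwards_inv n (s : 'S_n) (i : 'I_n) :
  rank_among_previous (backwards s)^-1%g i = smaller_after i.+1 (oneline s).
Proof.
rewrite -{2}[i](permKV s) smaller_after_oneline -(card_imset _ (@perm_inj _ s)).
apply: eq_card => j; rewrite -[j in RHS](permKV s) mem_imset ?inE; last exact: perm_inj.
rewrite !backwards_invE !permKV /= andbC.
by have := ltn_ord (s^-1 i)%g; have := ltn_ord (s^-1 j)%g; lia.
Qed.

(** * The letters of a word as an inversion table *)

Lemma letter_f1 n (w : word n) (i : 'I_n) :
  nth 0 (letters w) i = (rank_among_previous (backwards (f1 w))^-1%g i).+1.
Proof.
rewrite rank_backwards_inv perm_of_lineK.
by apply: f1_line_letter => // j; apply: letters_bound.
Qed.

Lemma letter_f2 n (w : word n) (i : 'I_n) :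
  nth 0 (letters w) i = (rank_among_previous (backwards (f2 w)) i).+1.
Proof.
rewrite rank_backwards -nth_oneline perm_of_lineK.
by apply: (@f2_steps_letter n _ n [::]) => // j; apply: letters_bound.
Qed.

Lemma backwardsK n : involutive (@backwards n).
Proof. by move=> s; apply: oneline_inj; rewrite !oneline_backwards revK. Qed.

(** The word that f2 sends to backwards r has the table of r as its letters, so
    injectivity of L is inherited from the inverse of f2. *)
Lemma rank_inj n (r t : 'S_n) :
  rank_among_previous r =1 rank_among_previous t -> r = t.
Proof.
move=> E; apply: (inv_inj (@backwardsK n)).
rewrite -(f2_invK (backwards r)) -(f2_invK (backwards t)).
congr f2; apply/letters_inj/(@eq_from_nth _ 0); rewrite !size_letters // => i lt_in.
by rewrite !(letter_f2 _ (Ordinal lt_in)) !f2_invK !backwardsK E.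
Qed.

(** Up to the shift by one, w is the inversion table both of the inverse of the
    left-hand side and of backwards (f2 w). *)
Lemma backwards_f1 n (w : word n) : backwards (f1 w) = (backwards (f2 w))^-1%g.
Proof.
apply: invg_inj; rewrite invgK; apply: rank_inj => i.
by apply: succn_inj; rewrite -letter_f1 -letter_f2.
Qed.

Theorem theorem1 (n : nat) (hn : 1 <= n) (sigma : 'S_n) :
  f1 (f2_inv sigma) = sigma <-> involution (backwards sigma).
Proof.
rewrite /involution -{3}(f2_invK sigma) -backwards_f1.
by split=> [-> | /(inv_inj (@backwardsK n))].
Qed.
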